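(* Let $A$ be a ring and let $M$ and $N$ be $A$-modules. Let $\Phi$ be the functor from the category $\mathrm{coExMod}(N,M)$ of coextensions of $N$ by $M$ to the category of $M$-cotorsors which sends a coextension $(f:N\to P,\ \alpha_f)$ to the $M$-cotorsor $(f,\tau_f)$ with $\tau_f(p)=(\alpha_f([p]),p)$ for $p\in P$, and which sends each morphism of coextensions $h$ to $h$ itself, regarded as a morphism of $M$-cotorsors. Then $\Phi$ is an equivalence of categories.
   Context: $A$ is a ring with multiplicative identity, not necessarily commutative; ''$A$-module'' means left $A$-module. $M$ and $N$ are fixed $A$-modules. The category of $A$-modules under $N$ has as objects the $A$-module homomorphisms $f:N\to P$, and as morphisms from $f:N\to P$ to $g:N\to Q$ the $A$-module homomorphisms $h:P\to Q$ with $h\circ f=g$. A coextension (of $N$ by $M$) is an injective $A$-module homomorphism $f:N\to P$ together with an isomorphism of $A$-modules $\alpha_f:\mathrm{coker}(f)\to M$. For $p\in P$, $[p]$ denotes its class in $\mathrm{coker}(f)$. A morphism $h:f\to g$ of $A$-modules under $N$ induces a homomorphism $\mathrm{coker}(f)\to\mathrm{coker}(g)$, $[p]\mapsto[h(p)]$. A morphism of coextensions from $f:N\to P$ to $g:N\to Q$ is a morphism $h:f\to g$ of $A$-modules under $N$ such that $\alpha_g([h(p)])=\alpha_f([p])$ for every $[p]\in\mathrm{coker}(f)$. $\mathrm{coExMod}(N,M)$ is the category of coextensions and morphisms of coextensions. For an object $f:N\to P$ under $N$, $\beta_f:N\to M\oplus P$ denotes the object under $N$ given by $\beta_f(n)=(0,f(n))$,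 and $\pi_P:\beta_f\to f$ is the morphism $\pi_P(m,p)=p$. For objects $f:N\to P$, $g:N\to Q$ under $N$, put $P\amalg_N Q=\mathrm{coker}\big((f,-g):N\to P\oplus Q\big)$; the class of $(p,q)$ in it is again written $(p,q)$. An $M$-cotorsor is an injective $A$-module homomorphism $f:N\to P$ together with a morphism $\tau_f:f\to\beta_f$ of $A$-modules under $N$ (that is, an $A$-module homomorphism $\tau_f:P\to M\oplus P$ with $\tau_f\circ f=\beta_f$) such that (1) $\pi_P(\tau_f(p))=p$ for each $p\in P$; (2) for each $(m,p)\in M\oplus P$ there exists a unique $(p_1,p_2)\in P\amalg_N P$ such that $\tau_f(p_1)+(0,p_2)=(m,p)$ (the left side is independent of the representative of the class $(p_1,p_2)$). A morphism of $M$-cotorsors from $f:N\to P$ to $g:N\to Q$ is a morphism $h:f\to g$ of $A$-modules under $N$ such that $\tau_g\circ h=(\mathrm{id}_M\oplus h)\circ\tau_f$. *)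

(* Defs.v *)
From HB Require Import structures.
From mathcomp Require Import all_boot all_algebra.
From mathcomp Require Import boolp.

Set Implicit Arguments.
Unset Strict Implicit.
Unset Printing Implicit Defensive.

Import GRing.Theory.
Local Open Scope ring_scope.
Local Open Scope quotient_scope.

Record category := Category {
  ob :> Type;
  hom : ob -> ob -> Type;
  idc : forall a, hom a a;
  comp : forall a b c, hom b c -> hom a b -> hom a c;
  comp_idl : forall a b (h : hom a b), comp (idc b) h = h;
  comp_idr : forall a b (h : hom a b), comp h (idc a) = h;
  comp_assoc : forall a b c d (k : hom c d) (h : hom b c) (g : hom a b),
    comp k (comp h g) = comp (comp k h) g
}.
Arguments idc {_} a.
Arguments comp {_ a b c}.

Record functor (C D : category) := Functor {
  fob :> C -> D;
  fhom : forall a b : C, hom a b -> hom (fob a) (fob b);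
  fhom_id : forall a : C, fhom (idc a) = idc (fob a);
  fhom_comp : forall (a b c : C) (h : hom b c) (g : hom a b),
    fhom (comp h g) = comp (fhom h) (fhom g)
}.
Arguments fhom {C D} _ {a b}.

Definition functor_id (C : category) : functor C C :=
  @Functor C C id (fun _ _ h => h) (fun=> erefl) (fun _ _ _ _ _ => erefl).

Section FunctorComp.
Variables (C D E : category) (G : functor D E) (F : functor C D).

Fact functor_comp_id (a : C) : fhom G (fhom F (idc a)) = idc (G (F a)).
Proof. by rewrite !fhom_id. Qed.

Fact functor_comp_comp (a b c : C) (h : hom b c) (g : hom a b) :
  fhom G (fhom F (comp h g)) = comp (fhom G (fhom F h)) (fhom G (fhom F g)).
Proof. by rewrite !fhom_comp. Qed.

Definition functor_comp : functor C E :=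
  @Functor C E (fun a => G (F a)) (fun _ _ h => fhom G (fhom F h))
    functor_comp_id functor_comp_comp.
End FunctorComp.

Record nat_iso (C D : category) (F G : functor C D) := NatIso {
  ni_fun : forall a : C, hom (F a) (G a);
  ni_inv : forall a : C, hom (G a) (F a);
  ni_natural : forall (a b : C) (h : hom a b),
    comp (ni_fun b) (fhom F h) = comp (fhom G h) (ni_fun a);
  ni_funK : forall a : C, comp (ni_inv a) (ni_fun a) = idc (F a);
  ni_invK : forall a : C, comp (ni_fun a) (ni_inv a) = idc (G a)
}.

Definition is_equivalence (C D : category) (F : functor C D) : Prop :=
  exists G : functor D C,
    inhabited (nat_iso (functor_comp G F) (functor_id C)) /\
    inhabited (nat_iso (functor_comp F G) (functor_id D)).

Section Coker.
Variables (A : pzRingType) (N P : lmodType A) (f : {linear N -> P}).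

(* [asbool] makes the image a decidable submodule, as [Quotient.quot] needs. *)
Definition img : {pred P} := fun p => `[< exists n, p = f n >].

Fact img_zmod_closed : zmod_closed img.
Proof.
split=> [|_ _ /asboolP[a ->] /asboolP[b ->]]; apply/asboolP.
  by exists 0; rewrite linear0.
by exists (a - b); rewrite linearB.
Qed.
HB.instance Definition _ := GRing.isZmodClosed.Build P img img_zmod_closed.

Definition coker : Type := Quotient.quot img.
HB.instance Definition _ := GRing.Zmodule.on coker.

Definition cls (p : P) : coker := \pi_(Quotient.quot img) p.

Lemma cls_eq p q : cls p = cls q <-> exists n, p - q = f n.
Proof.
split=> [/eqP|[n pqn]]; last apply/eqP;
  rewrite /cls -Quotient.idealrBE; first by move/asboolP.
by apply/asboolP; exists n.
Qed.

Lemma cls_repr (c : coker) : cls (repr c) = c.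
Proof. exact: reprK. Qed.

Lemma cls_onto (c : coker) : exists p, cls p = c.
Proof. by exists (repr c); exact: cls_repr. Qed.

Fact cls_is_zmod_morphism : zmod_morphism cls.
Proof. by move=> p q; rewrite /cls raddfB. Qed.
HB.instance Definition _ :=
  GRing.isZmodMorphism.Build P coker cls cls_is_zmod_morphism.

Definition coker_scale (a : A) (c : coker) : coker := cls (a *: repr c).

Lemma coker_scaleE a p : coker_scale a (cls p) = cls (a *: p).
Proof.
have [n e] : exists n, repr (cls p) - p = f n by apply/cls_eq; exact: cls_repr.
by apply/cls_eq; exists (a *: n); rewrite -scalerBr e linearZ.
Qed.

Fact coker_scalerA a b c : coker_scale a (coker_scale b c) = coker_scale (a * b) c.
Proof. by have [p <-] := cls_onto c; rewrite !coker_scaleE scalerA. Qed.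
Fact coker_scale1r : left_id 1 coker_scale.
Proof. by move=> c; have [p <-] := cls_onto c; rewrite coker_scaleE scale1r. Qed.
Fact coker_scalerDr : right_distributive coker_scale +%R.
Proof.
move=> a c d; have [p <-] := cls_onto c; have [q <-] := cls_onto d.
by rewrite -raddfD !coker_scaleE scalerDr raddfD.
Qed.
Fact coker_scalerDl c : {morph coker_scale^~ c : a b / a + b}.
Proof.
by move=> a b; have [p <-] := cls_onto c; rewrite !coker_scaleE scalerDl raddfD.
Qed.
HB.instance Definition _ := GRing.Zmodule_isLmodule.Build A coker
  coker_scalerA coker_scale1r coker_scalerDr coker_scalerDl.

Fact cls_is_scalable : scalable cls.
Proof. by move=> a p; rewrite -coker_scaleE. Qed.
HB.instance Definition _ := GRing.isScalable.Build A P coker *:%R cls cls_is_scalable.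

(* The map [cls p |-> g p] on the cokernel induced by a [g] vanishing on the
   image of [f]; see [coker_liftE]. *)
Definition coker_lift (Q : lmodType A) (g : {linear P -> Q})
  (gf0 : forall n, g (f n) = 0) (c : coker) : Q := g (repr c).

Lemma coker_liftE (Q : lmodType A) (g : {linear P -> Q})
  (gf0 : forall n, g (f n) = 0) p : coker_lift gf0 (cls p) = g p.
Proof.
have [n e] : exists n, repr (cls p) - p = f n by apply/cls_eq; exact: cls_repr.
by apply/eqP; rewrite -subr_eq0 -linearB e gf0.
Qed.
End Coker.

Section Under.
Variables (A : pzRingType) (N : lmodType A).

Record under := Under {
  under_mod :> lmodType A;
  under_map : {linear N -> under_mod}
}.

Record under_hom (f g : under) := UnderHom {
  under_fun :> {linear f -> g};
  under_funE : forall n, under_fun (under_map f n) = under_map g n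
}.

Lemma under_hom_ext (f g : under) (h k : under_hom f g) :
  (forall p, h p = k p) -> h = k.
Proof.
case: h k => [h hE] [k kE] /= hk.
have e : h = k.
  case: h k hk {hE kE} => [h [hm hs]] [k [km ks]] /= /funext hk; subst k.
  rewrite (_ : hm = km); first rewrite (_ : hs = ks) //.
    by case: hs ks => s [t]; congr GRing.isScalable.Axioms_;
      exact: Prop_irrelevance.
  by case: hm km => s [t]; congr GRing.isNmodMorphism.Axioms_;
    exact: Prop_irrelevance.
by subst k; congr UnderHom; exact: Prop_irrelevance.
Qed.

Definition under_id (f : under) : under_hom f f :=
  @UnderHom f f idfun (fun=> erefl).

Fact under_compE (f g k : under) (h' : under_hom g k) (h : under_hom f g) n :
  (h' \o h) (under_map f n) = under_map k n.
Proof. by rewrite /= !under_funE. Qed.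

Definition under_comp (f g k : under) (h' : under_hom g k) (h : under_hom f g) :
  under_hom f k := UnderHom (under_compE h' h).

Section Pushout.
Variables f g : under.

Definition anti_diag (n : N) : f * g := (under_map f n, - under_map g n).

Fact anti_diag_is_linear : linear anti_diag.
Proof.
by move=> a x y; rewrite /anti_diag !linearP.
Qed.
HB.instance Definition _ :=
  GRing.isLinear.Build A N (f * g)%type _ anti_diag anti_diag_is_linear.

Definition pushout : lmodType A := coker anti_diag.
End Pushout.
End Under.

Section Coextensions.
Variables (A : pzRingType) (N M : lmodType A).

Record coext := Coext {
  coext_under :> under N;
  coext_inj : injective (under_map coext_under);
  coext_iso : {linear coker (under_map coext_under) -> M};
  coext_iso_bij : bijective coext_iso
}.

Definition coext_cls (f : coext) (p : f) : coker (under_map f) :=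
  cls (under_map f) p.

Record coext_hom (f g : coext) := CoextHom {
  coext_fun :> under_hom f g;
  coext_funE : forall p : f,
    coext_iso g (coext_cls (coext_fun p)) = coext_iso f (coext_cls p)
}.

Lemma coext_hom_ext (f g : coext) (h k : coext_hom f g) :
  (forall p, h p = k p) -> h = k.
Proof.
case: h k => [h hE] [k kE] /= /under_hom_ext e; subst k.
by congr CoextHom; exact: Prop_irrelevance.
Qed.

Definition coext_id (f : coext) : coext_hom f f :=
  @CoextHom f f (under_id f) (fun=> erefl).

Fact coext_compE (f g k : coext) (h' : coext_hom g k) (h : coext_hom f g) (p : f) :
  coext_iso k (coext_cls (under_comp h' h p)) = coext_iso f (coext_cls p).
Proof. by rewrite /= !coext_funE. Qed.

Definition coext_comp (f g k : coext) (h' : coext_hom g k) (h : coext_hom f g) :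
  coext_hom f k := CoextHom (coext_compE h' h).

Definition coExMod : category.
Proof.
by refine (@Category coext coext_hom coext_id coext_comp _ _ _) => *;
  apply: coext_hom_ext.
Defined.

Definition beta_map (f : under N) (n : N) : M * f := (0, under_map f n).

Fact beta_map_is_linear f : linear (beta_map f).
Proof.
move=> a x y; rewrite /beta_map linearP.
by congr pair; rewrite /= scaler0 addr0.
Qed.
HB.instance Definition _ (f : under N) :=
  GRing.isLinear.Build A N (M * f)%type _ (beta_map f) (beta_map_is_linear f).

Definition beta (f : under N) : under N := @Under _ _ (M * f)%type (beta_map f).

Definition beta_proj (f : under N) : under_hom (beta f) f :=
  @UnderHom _ _ (beta f) f snd (fun=> erefl).

Section Translate.
Variables (f : under N) (tau : under_hom f (beta f)).

Definition translate_pre (x : f * f) : M * f := tau x.1 + (0, x.2).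

Fact translate_pre_is_linear : linear translate_pre.
Proof.
move=> a x y; rewrite /translate_pre /= linearP scalerDr addrACA.
by congr (_ + _); congr pair; rewrite /= scaler0 addr0.
Qed.
HB.instance Definition _ :=
  GRing.isLinear.Build A (f * f)%type (M * f)%type _ translate_pre
    translate_pre_is_linear.

Fact translate_pre_anti_diag n : translate_pre (anti_diag f f n) = 0.
Proof.
rewrite /translate_pre /= under_funE.
by congr pair; rewrite /= ?addr0 ?subrr.
Qed.

(* [(p1, p2) |-> tau p1 + (0, p2)] on the pushout *)
Definition translate : pushout f f -> M * f :=
  coker_lift translate_pre_anti_diag.

Lemma translateE p1 p2 :
  translate (cls (anti_diag f f) (p1, p2)) = tau p1 + (0, p2).
Proof. by rewrite /translate coker_liftE. Qed.
End Translate.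

Record cotorsor := Cotorsor {
  cotor_under :> under N;
  cotor_inj : injective (under_map cotor_under);
  cotor_tau : under_hom cotor_under (beta cotor_under);
  cotor_proj : forall p, beta_proj cotor_under (cotor_tau p) = p;
  cotor_translate : forall (m : M) (p : cotor_under),
    exists! c : pushout cotor_under cotor_under, translate cotor_tau c = (m, p)
}.

Record cotor_hom (f g : cotorsor) := CotorHom {
  cotor_fun :> under_hom f g;
  cotor_funE : forall p : f,
    cotor_tau g (cotor_fun p) =
      ((cotor_tau f p).1, cotor_fun (cotor_tau f p).2)
}.

Lemma cotor_hom_ext (f g : cotorsor) (h k : cotor_hom f g) :
  (forall p, h p = k p) -> h = k.
Proof.
case: h k => [h hE] [k kE] /= /under_hom_ext e; subst k.
by congr CotorHom; exact: Prop_irrelevance.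
Qed.

Fact cotor_idE (f : cotorsor) (p : f) :
  cotor_tau f (under_id f p) =
    ((cotor_tau f p).1, under_id f (cotor_tau f p).2).
Proof. exact: surjective_pairing. Qed.

Definition cotor_id (f : cotorsor) : cotor_hom f f := CotorHom (@cotor_idE f).

Fact cotor_compE (f g k : cotorsor) (h' : cotor_hom g k) (h : cotor_hom f g) (p : f) :
  cotor_tau k (under_comp h' h p) =
    ((cotor_tau f p).1, under_comp h' h (cotor_tau f p).2).
Proof. by rewrite /= !cotor_funE. Qed.

Definition cotor_comp (f g k : cotorsor) (h' : cotor_hom g k) (h : cotor_hom f g) :
  cotor_hom f k := CotorHom (cotor_compE h' h).

Definition Cotors : category.
Proof.
by refine (@Category cotorsor cotor_hom cotor_id cotor_comp _ _ _) => *;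
  apply: cotor_hom_ext.
Defined.

Section PhiOb.
Variable f : coext.

Definition Phi_tau_fun (p : f) : M * f := (coext_iso f (coext_cls p), p).

Fact Phi_tau_is_linear : linear Phi_tau_fun.
Proof. by move=> a x y; rewrite /Phi_tau_fun /coext_cls !linearP. Qed.
HB.instance Definition _ :=
  GRing.isLinear.Build A f (M * f)%type _ Phi_tau_fun Phi_tau_is_linear.

Fact Phi_tau_under n : Phi_tau_fun (under_map f n) = under_map (beta f) n.
Proof.
rewrite /Phi_tau_fun /coext_cls (_ : cls _ _ = 0) ?linear0 //.
rewrite -(linear0 (cls (under_map f))).
by apply/cls_eq; exists n; rewrite subr0.
Qed.

Definition Phi_tau : under_hom f (beta f) := @UnderHom _ _ f (beta f) Phi_tau_fun Phi_tau_under.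

Fact Phi_translate (m : M) (p : f) :
  exists! c : pushout f f, translate Phi_tau c = (m, p).
Proof.
have trE p1 p2 : translate Phi_tau (cls (anti_diag f f) (p1, p2))
    = (coext_iso f (coext_cls p1), p1 + p2).
  by rewrite translateE; congr pair; rewrite /= addr0.
have [g isoK gK] := coext_iso_bij f.
have [p1 p1E] := cls_onto (g m).
exists (cls (anti_diag f f) (p1, p - p1)); split.
  by rewrite trE /coext_cls p1E gK addrC subrK.
move=> c; have [[q1 q2] <-] := cls_onto c; rewrite trE => -[mE pE].
apply/cls_eq.
have [n nE] : exists n, p1 - q1 = under_map f n.
  by apply/cls_eq; rewrite p1E -mE isoK.
exists n; congr pair => //=.
by rewrite -nE -pE opprB addrAC addrK.
Qed.

Definition Phi_ob : cotorsor :=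
  @Cotorsor f (@coext_inj f) Phi_tau (fun=> erefl) Phi_translate.
End PhiOb.

Fact Phi_homE (f g : coext) (h : coext_hom f g) (p : Phi_ob f) :
  cotor_tau (Phi_ob g) (coext_fun h p) =
    ((cotor_tau (Phi_ob f) p).1, coext_fun h (cotor_tau (Phi_ob f) p).2).
Proof. by rewrite /= /Phi_tau_fun coext_funE. Qed.

Definition Phi_hom (f g : coext) (h : coext_hom f g) :
  cotor_hom (Phi_ob f) (Phi_ob g) := @CotorHom (Phi_ob f) (Phi_ob g) h (Phi_homE h).

Definition Phi : functor coExMod Cotors.
Proof.
by refine (@Functor coExMod Cotors Phi_ob Phi_hom _ _) => *;
  apply: cotor_hom_ext.
Defined.
End Coextensions.

(* Main.v *)
(* The first component of the structure map of an M-cotorsor vanishes on N,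
   hence induces a map coker f -> M. Applied to the equation
   tau p1 + (0, p2) = (m, p), existence in the torsor axiom gives its
   surjectivity and uniqueness its injectivity. This yields an inverse to Phi
   that is the identity on underlying modules under N. *)
Require Import Defs.
From HB Require Import structures.
From mathcomp Require Import all_boot all_algebra.
From mathcomp Require Import boolp.

Set Implicit Arguments.
Unset Strict Implicit.
Unset Printing Implicit Defensive.

Import GRing.Theory.
Local Open Scope ring_scope.

(** Since [cls] is linear and onto, linearity can be checked on representatives. *)
Lemma coker_lift_is_linear (A : pzRingType) (N P Q : lmodType A)
    (f : {linear N -> P}) (g : {linear P -> Q}) (gf0 : forall n, g (f n) = 0) :
  linear (coker_lift gf0).
Proof.
move=> a c d; have [p <-] := cls_onto c; have [q <-] := cls_onto d.
by rewrite -linearP !coker_liftE linearP.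
Qed.

(** [bijective] demands an inverse function, so preimages are picked by choice, through [cid]. *)
Lemma inj_onto_bij (T U : Type) (g : T -> U) :
  injective g -> (forall u, exists t, g t = u) -> bijective g.
Proof.
move=> g_inj g_onto; pose h u := projT1 (cid (g_onto u)).
have hK : cancel h g by move=> u; exact: projT2 (cid (g_onto u)).
by exists h => // t; apply: g_inj; rewrite hK.
Qed.

Section CotorsorCoextension.
Variables (A : pzRingType) (N M : lmodType A).

Section Object.
Variable f : cotorsor N M.

Definition cotor_class (p : f) : M := (cotor_tau f p).1.

Lemma cotor_class_is_linear : linear cotor_class.
Proof. by move=> a x y; rewrite /cotor_class linearP. Qed.
HB.instance Definition _ :=
  GRing.isLinear.Build A f M _ cotor_class cotor_class_is_linear.

(** The projection axiom fixes the second component, so the structure map carries the same data as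
    [cotor_class]. *)
Lemma cotor_tauE p : cotor_tau f p = (cotor_class p, p).
Proof. by rewrite [LHS]surjective_pairing; congr pair; exact: cotor_proj. Qed.

Lemma cotor_class_under n : cotor_class (under_map f n) = 0.
Proof. by rewrite /cotor_class under_funE. Qed.

Definition cotor_alpha : coker (under_map f) -> M :=
  coker_lift cotor_class_under.
HB.instance Definition _ := GRing.isLinear.Build A (coker (under_map f)) M _
  cotor_alpha (coker_lift_is_linear cotor_class_under).

Lemma cotor_alphaE p : cotor_alpha (cls (under_map f) p) = cotor_class p.
Proof. exact: coker_liftE. Qed.

Lemma translate_cotorE p1 p2 :
  translate (cotor_tau f) (cls (anti_diag f f) (p1, p2))
    = (cotor_class p1, p1 + p2).
Proof. by rewrite translateE cotor_tauE; congr pair; rewrite /= addr0. Qed.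

(** When the class of [p] vanishes, [(p, 0)] and [(0, p)] both translate to [(0, p)], so uniqueness
    identifies them in the pushout. *)
Lemma cotor_class_eq0 p : cotor_class p = 0 -> exists n, p = under_map f n.
Proof.
move=> p0; have [c [_ c_uniq]] := cotor_translate (0 : M) p.
have cp0 : c = cls (anti_diag f f) (p, 0).
  by apply: c_uniq; rewrite translate_cotorE p0 addr0.
have c0p : c = cls (anti_diag f f) (0, p).
  by apply: c_uniq; rewrite translate_cotorE linear0 add0r.
(* The difference [(p, - p)] is then some [anti_diag n]; its first component exhibits [p] in the
   image of [N]. *)
have /cls_eq[n [pn _]] := etrans (esym cp0) c0p.
by exists n; rewrite -pn subr0.
Qed.

Lemma cotor_alpha_inj : injective cotor_alpha.
Proof.
move=> c d; have [p <-] := cls_onto c; have [q <-] := cls_onto d.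
(* By [cls_eq] it suffices that [p - q] comes from [N], which follows once its [cotor_class] is
   zero. *)
rewrite !cotor_alphaE => pq; apply/cls_eq/cotor_class_eq0.
by rewrite linearB /= pq subrr.
Qed.

Lemma cotor_alpha_onto m : exists c, cotor_alpha c = m.
Proof.
(* Any second component would serve as well as 0: the preimage of [m] is read off the first
   component of the equation. *)
have [c [+ _]] := cotor_translate m (0 : f).
have [[p1 p2] <-] := cls_onto c; rewrite translate_cotorE => -[<- _].
by exists (cls (under_map f) p1); rewrite cotor_alphaE.
Qed.

Definition coext_of_cotor : coext N M :=
  @Coext A N M f (@cotor_inj _ _ _ f) cotor_alpha
    (inj_onto_bij cotor_alpha_inj cotor_alpha_onto).

Lemma coext_of_cotor_isoE (p : f) :
  coext_iso coext_of_cotor (@coext_cls _ _ _ coext_of_cotor p) = cotor_class p.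
Proof. exact: cotor_alphaE. Qed.

End Object.

(** On first components, compatibility of [h] with the structure maps says that [h] preserves
    [cotor_class]. *)
Lemma coext_of_cotor_homE (f g : cotorsor N M) (h : cotor_hom f g)
    (p : coext_of_cotor f) :
  coext_iso (coext_of_cotor g) (@coext_cls _ _ _ (coext_of_cotor g) (h p))
    = coext_iso (coext_of_cotor f) (coext_cls p).
Proof. by rewrite !coext_of_cotor_isoE /cotor_class cotor_funE. Qed.

Definition coext_of_cotor_hom (f g : cotorsor N M) (h : cotor_hom f g) :
    coext_hom (coext_of_cotor f) (coext_of_cotor g) :=
  @CoextHom _ _ _ (coext_of_cotor f) (coext_of_cotor g) h
    (coext_of_cotor_homE h).

Definition Psi : functor (Cotors N M) (coExMod N M).
Proof.
by refine (@Functor (Cotors N M) (coExMod N M)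
  coext_of_cotor coext_of_cotor_hom _ _) => *; apply: coext_hom_ext.
Defined.

Lemma Psi_Phi_isoE (f : coext N M) (p : f) :
  coext_iso (coext_of_cotor (Phi_ob f))
      (@coext_cls _ _ _ (coext_of_cotor (Phi_ob f)) p)
    = coext_iso f (coext_cls p).
Proof. exact: coext_of_cotor_isoE. Qed.

(** The round trip rebuilds the isomorphism as a [coker_lift] that agrees with the original on every
    class, so the identity of the module is a morphism both ways. *)
Definition Psi_Phi_fun (f : coext N M) :
    coext_hom (coext_of_cotor (Phi_ob f)) f :=
  @CoextHom _ _ _ (coext_of_cotor (Phi_ob f)) f (under_id f)
    (fun p => esym (@Psi_Phi_isoE f p)).

Definition Psi_Phi_inv (f : coext N M) :
    coext_hom f (coext_of_cotor (Phi_ob f)) :=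
  @CoextHom _ _ _ f (coext_of_cotor (Phi_ob f)) (under_id f)
    (@Psi_Phi_isoE f).

Lemma Phi_Psi_tauE (f : cotorsor N M) (p : f) :
  cotor_tau (Phi_ob (coext_of_cotor f)) p = cotor_tau f p.
Proof. by rewrite [RHS]cotor_tauE -coext_of_cotor_isoE. Qed.

Lemma Phi_Psi_funE (f : cotorsor N M) (p : Phi_ob (coext_of_cotor f)) :
  cotor_tau f (under_id f p)
    = ((cotor_tau (Phi_ob (coext_of_cotor f)) p).1,
       under_id f (cotor_tau (Phi_ob (coext_of_cotor f)) p).2).
Proof. by rewrite Phi_Psi_tauE; exact: surjective_pairing. Qed.

Lemma Phi_Psi_invE (f : cotorsor N M) (p : f) :
  cotor_tau (Phi_ob (coext_of_cotor f)) (under_id f p)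
    = ((cotor_tau f p).1, under_id f (cotor_tau f p).2).
Proof. by rewrite Phi_Psi_tauE; exact: surjective_pairing. Qed.

Definition Phi_Psi_fun (f : cotorsor N M) :
    cotor_hom (Phi_ob (coext_of_cotor f)) f :=
  @CotorHom _ _ _ (Phi_ob (coext_of_cotor f)) f (under_id f)
    (@Phi_Psi_funE f).

Definition Phi_Psi_inv (f : cotorsor N M) :
    cotor_hom f (Phi_ob (coext_of_cotor f)) :=
  @CotorHom _ _ _ f (Phi_ob (coext_of_cotor f)) (under_id f)
    (@Phi_Psi_invE f).

End CotorsorCoextension.

Theorem theorem3p13 (A : pzRingType) (M N : lmodType A) :
  is_equivalence (Phi N M).
Proof.
exists (Psi N M); split; constructor.
  (* All components are identities on underlying modules, so naturality and the inverse laws hold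
     pointwise by computation. *)
  by refine (@NatIso _ _ (functor_comp (Psi N M) (Phi N M))
    (functor_id (coExMod N M)) (@Psi_Phi_fun A N M) (@Psi_Phi_inv A N M) _ _ _)
    => *; apply: coext_hom_ext.
by refine (@NatIso _ _ (functor_comp (Phi N M) (Psi N M))
  (functor_id (Cotors N M)) (@Phi_Psi_fun A N M) (@Phi_Psi_inv A N M) _ _ _)
  => *; apply: cotor_hom_ext.
Qed.
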